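(* Let $k,n\in\mathbb{Z}^+$. (i) $\binom{kn}{n}\ \big|\ (2k-1)C_n\binom{2kn}{2n}$, and the quotient $(2k-1)C_n\binom{2kn}{2n}\big/\binom{kn}{n}$ is odd if and only if $n+1$ is a power of two. (ii) Let $(k+1)'$ denote the odd part of $k+1$ (i.e. $k+1$ divided by the largest power of $2$ dividing it). Then $\binom{2n}{n}\ \big|\ (k+1)'C_n^{(k-1)}\binom{2kn}{kn}$, and the quotient $(k+1)'C_n^{(k-1)}\binom{2kn}{kn}\big/\binom{2n}{n}$ is odd if and only if $(k-1)n+1$ is a power of two. (iii) $2^{k-1}\binom{2n}{n}\ \Big|\ \binom{2(2^k-1)n}{(2^k-1)n}C_n^{(2^k-2)}$.
   Context: $C_n=\frac{1}{n+1}\binom{2n}{n}$ is the $n$th Catalan number. For $h,m\in\mathbb{N}$, $C_m^{(h)}=\frac{1}{hm+1}\binom{(h+1)m}{m}$ is the generalized Catalan number of order $h$ (an integer). ''Power of two'' means $2^a$ for some $a\in\mathbb{N}$. *)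

(* Defs.v *)
From mathcomp Require Import all_boot.

Set Implicit Arguments.
Unset Strict Implicit.
Unset Printing Implicit Defensive.

(* All the divisions below are exact: see dvdn_catalan, dvdn_gen_catalan and
   pfactor_dvdnn; hence %/ computes the integer quotient. *)
Definition catalan (n : nat) : nat := 'C(2 * n, n) %/ (n + 1).

Definition gen_catalan (h m : nat) : nat :=
  'C((h + 1) * m, m) %/ (h * m + 1).

Definition odd_part (m : nat) : nat := m %/ 2 ^ logn 2 m.

Definition power_of_two (m : nat) : Prop := exists a : nat, m = 2 ^ a.

Lemma dvdn_gen_catalan (h m : nat) : h * m + 1 %| 'C((h + 1) * m, m).
Proof.
case: m => [|m]; first by rewrite muln0 bin0.
have e : (h + 1) * m.+1 - m = (h * m.+1 + 1).
  by rewrite mulnDl mul1n -addnBA // subSnn.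
have := mul_bin_left ((h + 1) * m.+1) m; rewrite e => E.
have co : coprime (h * m.+1 + 1) m.+1.
  by rewrite /coprime gcdnC gcdnMDl gcdn1.
by rewrite -(Gauss_dvdr _ co) E dvdn_mulr.
Qed.

Lemma dvdn_catalan (n : nat) : n + 1 %| 'C(2 * n, n).
Proof. by have := dvdn_gen_catalan 1 n; rewrite mul1n. Qed.

Lemma odd_partE (m : nat) : 0 < m -> odd_part m = m`_2^'.
Proof.
move=> m_gt0; rewrite /odd_part -p_part -[X in X %/ _](partnC 2 m_gt0).
by rewrite mulKn // part_gt0.
Qed.

(* Main.v *)
Require Import Defs.
From mathcomp Require Import all_boot.
From mathcomp Require Import zify ring.

(** Cancelling factorials and using [(2 m)! = 2 ^ m * m! * (2 m - 1)!!], both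
    quotients of (i) and (ii) become [c * 2 ^ m * P / (m + 1)!], where [P] is
    the product of the [m] consecutive odd numbers from [2 a + 1] on and [c] is
    odd: [(a, m, c) = ((k - 1) n, n, 2 k - 1)] in (i) and
    [(n, (k - 1) n, (k + 1)')] in (ii). Modulo an odd number, [P] is, up to a
    power of 2, a product of [m] consecutive integers; so the odd part of [m!]
    divides [P], and that of [(m + 1)!] divides [(2 (a + m) + 1) P], where
    [2 (a + m) + 1] can be traded for [c] modulo the odd part of [m + 1].
    The 2-adic valuation of the quotient is therefore [m - v_2((m + 1)!)], that
    is [s - 1] with [s] the number of binary digits 1 of [m + 1]. For (iii) one
    applies this to (ii) with [2 ^ k - 1] in place of [k]: a positive multiple
    of [2 ^ j - 1] has at least [j] binary digits equal to 1. *)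

(** * Products of consecutive odd numbers *)

Definition odd_prod (a m : nat) : nat := \prod_(i < m) (2 * (a + i) + 1).

Lemma odd_prodS (a m : nat) :
  odd_prod a m.+1 = odd_prod a m * (2 * (a + m) + 1).
Proof. by rewrite /odd_prod big_ord_recr. Qed.

Lemma odd_odd_prod (a m : nat) : odd (odd_prod a m).
Proof.
elim: m => [|m IHm]; first by rewrite /odd_prod big_ord0.
by rewrite odd_prodS oddM IHm; lia.
Qed.

(** This is the ratio of [(2 j)! / j! = 2 ^ j (2 j - 1)!!] at [j = a + m] and at [j = a], cleared of
    denominators. *)
Lemma fact_double_odd_prod (a m : nat) :
  2 ^ m * odd_prod a m * ((2 * a)`! * (a + m)`!) = (2 * (a + m))`! * a`!.
Proof.
elim: m => [|m IHm]; first by rewrite /odd_prod big_ord0 addn0; ring.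
rewrite odd_prodS (addnS a) (_ : 2 * (a + m).+1 = (2 * (a + m)).+2); last by lia.
rewrite !factS expnS.
transitivity ((2 * (a + m)).+2 * (2 * (a + m)).+1 * ((2 * (a + m))`! * a`!)).
  rewrite -IHm (_ : (2 * (a + m)).+2 = 2 * (a + m).+1); last by lia.
  by rewrite addn1; ring.
by ring.
Qed.

Lemma dvdn_fact_prod_consec (y m : nat) : m`! %| \prod_(i < m) (y.+1 + i).
Proof.
have fact_prod : (\prod_(i < m) (y.+1 + i)) * y`! = (y + m)`!.
  elim: m => [|m IHm]; first by rewrite big_ord0 mul1n addn0.
  by rewrite big_ord_recr /= mulnAC IHm addnS factS addSn mulnC.
have := bin_fact (leq_addl y m); rewrite addnK -fact_prod mulnA => /eqP.
by rewrite eqn_pmul2r ?fact_gt0 // => /eqP <-; exact: dvdn_mull.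
Qed.

Lemma dvdn_odd_prod (N a m : nat) : odd N -> N %| m`! -> N %| odd_prod a m.
Proof.
move=> oddN dvNm.
(* [N./2.+1] inverts 2 modulo [N]. *)
have [y Dy] : exists y, N./2.+1 * (2 * a + 1) = y.+1.
  by exists (N./2.+1 * (2 * a + 1)).-1; rewrite prednK // muln_gt0; lia.
have eq_prod : odd_prod a m = \prod_(i < m) (2 * (y.+1 + i)) %[mod N].
  apply: (big_ind2 (fun u v => u = v %[mod N])) => // [u1 u2 v1 v2 eu ev|i _].
    by rewrite -modnMm eu ev modnMm.
  have -> : 2 * (y.+1 + i) = (2 * a + 1) * N + (2 * (a + i) + 1); last first.
    by rewrite modnMDl.
  rewrite -Dy; have: 2 * N./2.+1 = N.+1 by lia.
  by rewrite mulnDr mulnA => ->; ring.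
rewrite /dvdn eq_prod -/(dvdn _ _) big_split /= dvdn_mull //.
exact: dvdn_trans dvNm (dvdn_fact_prod_consec y m).
Qed.

Lemma odd_partnC2 (m : nat) : odd m`_2^'.
Proof. by have := part_pnat 2^' m; rewrite odd_2'nat. Qed.

(** * 2-adic valuation of factorials and binary digits *)

Definition log2_fact (m : nat) : nat := logn 2 m`!.

(** By Legendre's formula, [m - log2_fact m] is the number of binary digits 1 of [m]; appending a
    digit 0 leaves it unchanged. *)
Lemma log2_fact_double (m : nat) : log2_fact (2 * m) = m + log2_fact m.
Proof.
have := fact_double_odd_prod 0 m; rewrite !add0n muln0 fact0 mul1n muln1.
have odd_prod_gt0 := odd_gt0 (odd_odd_prod 0 m).
rewrite /log2_fact => <-; rewrite !lognM ?muln_gt0 ?expn_gt0 ?fact_gt0 //.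
by rewrite pfactorK // (lognE 2 (odd_prod _ _)) dvdn2 odd_odd_prod !andbF addn0.
Qed.

Lemma log2_fact_doubleS (m : nat) : log2_fact (2 * m).+1 = m + log2_fact m.
Proof.
rewrite -log2_fact_double /log2_fact factS lognM ?fact_gt0 // lognE dvdn2.
by rewrite (_ : odd _ = true) ?andbF //; lia.
Qed.

Lemma log2_fact_lt (m : nat) : 0 < m -> log2_fact m < m.
Proof.
elim/ltn_ind: m => m IHm m_gt0; have [m1|m_neq1] := eqVneq m 1.
  by rewrite m1 /log2_fact logn1.
have IH := IHm m./2 ltac:(lia) ltac:(lia).
have [oddm|evenm] := boolP (odd m).
  rewrite (_ : m = (2 * m./2).+1) ?log2_fact_doubleS; lia.
rewrite (_ : m = 2 * m./2) ?log2_fact_double; lia.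
Qed.

Lemma log2_fact_pow2 (j : nat) : (log2_fact (2 ^ j)).+1 = 2 ^ j.
Proof.
elim: j => [|j IHj]; first by rewrite /log2_fact logn1.
by rewrite expnS log2_fact_double; lia.
Qed.

Lemma log2_fact_maxP (m : nat) :
  (log2_fact m.+1 == m) <-> power_of_two m.+1.
Proof.
split=> [/eqP|[j Dm]]; last by rewrite -eqSS Dm log2_fact_pow2.
elim/ltn_ind: m => m IHm; case: m => [_|m] in IHm *; first by exists 0.
have [evenm|oddm] := boolP (odd m); last first.
  have Dm : m.+2 = 2 * (m./2).+1 by lia.
  rewrite Dm log2_fact_double => eq_log.
  by case: (IHm m./2 ltac:(lia) ltac:(lia)) => j ->; exists j.+1; rewrite expnS.
(* An odd number above 1 has a second digit 1, as its half is positive; equality is impossible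
   here. *)
have Dm : m.+2 = (2 * (m./2).+1).+1 by lia.
rewrite Dm log2_fact_doubleS.
by have := log2_fact_lt (m./2.+1) isT; lia.
Qed.

(** The binary digits of [2 ^ j * q + r] are those of [q] followed by those of [r], so the numbers
    of ones add up. *)
Lemma log2_fact_base_pow2 (j q r : nat) : r < 2 ^ j ->
  log2_fact (2 ^ j * q + r) = (2 ^ j).-1 * q + log2_fact q + log2_fact r.
Proof.
elim: j r => [|j IHj] r.
  by rewrite ltnS leqn0 => /eqP ->; rewrite mul1n addn0 /log2_fact logn1 addn0.
rewrite expnS => lt_r; have {}IHj := IHj r./2 ltac:(lia).
have pow_gt0 : 0 < 2 ^ j by rewrite expn_gt0.
have eq_coef : 2 ^ j * q + (2 ^ j).-1 * q = (2 * 2 ^ j).-1 * q.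
  by rewrite -mulnDl; congr (_ * _); lia.
have [oddr|evenr] := boolP (odd r).
  have Dr : r = (2 * r./2).+1 by lia.
  rewrite [in LHS]Dr addnS -mulnA -mulnDr log2_fact_doubleS IHj.
  by rewrite [in RHS]Dr log2_fact_doubleS; lia.
have Dr : r = 2 * r./2 by lia.
rewrite [in LHS]Dr -mulnA -mulnDr log2_fact_double IHj.
by rewrite [in RHS]Dr log2_fact_double; lia.
Qed.

Lemma leq_log2_factD (q r : nat) :
  log2_fact q + log2_fact r <= log2_fact (q + r).
Proof.
rewrite /log2_fact -lognM ?fact_gt0 //.
rewrite dvdn_leq_log ?fact_gt0 // -(bin_fact (leq_addr r q)) addKn.
exact: dvdn_mull.
Qed.

Lemma log2_fact_mul_pred_pow2 (j m : nat) :
  0 < m -> (2 ^ j).-1 %| m -> log2_fact m + j <= m.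
Proof.
case: j => [m_gt0 _|j]; first by have := log2_fact_lt m m_gt0; lia.
elim/ltn_ind: m => m IHm m_gt0 dv_m.
have pow_gt1 : 1 < 2 ^ j.+1 by rewrite (ltn_exp2l 0).
have [lt_m|le_m] := ltnP m (2 ^ j.+1).
  (* The only positive multiple in this range is [2 ^ j.+1 - 1]; its valuation comes from that of
     the factorial of [2 ^ j.+1]. *)
  have Dm : 2 ^ j.+1 = m.+1 by have := dvdn_leq m_gt0 dv_m; lia.
  have := log2_fact_pow2 j.+1; rewrite Dm /log2_fact factS lognM ?fact_gt0 //.
  by rewrite -Dm pfactorK //; lia.
(* Adding the base-[2 ^ j.+1] digits keeps the multiple and does not increase
   the number of ones, [m - log2_fact m]. *)
have digits := log2_fact_base_pow2 j.+1.
move: (2 ^ j.+1) digits pow_gt1 le_m dv_m IHm => b digits b_gt1 le_m dv_m IHm.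
have Dm := divn_eq m b; have lt_r : m %% b < b by rewrite ltn_mod; lia.
have q_gt0 : 0 < m %/ b by rewrite divn_gt0; lia.
move: (m %/ b) (m %% b) q_gt0 lt_r Dm => q r q_gt0 lt_r Dm.
have Db : q * b = b.-1 * q + q by rewrite -mulSnr prednK ?(mulnC q) //; lia.
have q_le : q <= b.-1 * q by rewrite leq_pmull //; lia.
have dv_qr : b.-1 %| q + r.
  by move: dv_m; rewrite Dm Db -addnA dvdn_addr ?dvdn_mulr.
have IH := IHm (q + r) ltac:(lia) ltac:(lia) dv_qr.
have log_m := digits q r lt_r; rewrite mulnC -Dm in log_m.
by have := leq_log2_factD q r; lia.
Qed.

(** * The quotient for general [a], [m] and [c] *)

Section OddQuotient.

Variables (a m c : nat).
Hypothesis odd_c : odd c.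
Hypothesis exchange_c :
  forall t, (m.+1)`_2^' %| t * (2 * (a + m) + 1) -> (m.+1)`_2^' %| t * c.

Lemma dvdn_partC_fact_odd_prod : (m.+1`!)`_2^' %| c * odd_prod a m.
Proof.
have dv_S : (m.+1`!)`_2^' %| odd_prod a m.+1.
  by apply: dvdn_odd_prod; rewrite ?odd_partnC2 ?dvdn_part.
have dv_m : (m`!)`_2^' %| odd_prod a m.
  by apply: dvdn_odd_prod; rewrite ?odd_partnC2 ?dvdn_part.
move: dv_S; rewrite odd_prodS factS partnM ?fact_gt0 //.
(* Cancelling the odd part of [m!] leaves the cofactor [t] times the last odd factor, the form that
   [exchange_c] accepts. *)
case/dvdnP: dv_m => t ->; rewrite mulnAC dvdn_pmul2r ?part_gt0 //.
by move=> /exchange_c dv_t; rewrite mulnA dvdn_pmul2r ?part_gt0 // mulnC.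
Qed.

Lemma odd_quotientP : exists2 u, odd u &
  c * (2 ^ m * odd_prod a m) = 2 ^ (m - log2_fact m.+1) * u * m.+1`!.
Proof.
have /dvdnP[u Du] := dvdn_partC_fact_odd_prod.
exists u.
  have : odd (c * odd_prod a m) by rewrite oddM odd_c odd_odd_prod.
  by rewrite Du oddM => /andP[].
have le_m : log2_fact m.+1 <= m by have := log2_fact_lt m.+1 isT; lia.
rewrite mulnCA Du -[in RHS](partnC 2 (fact_gt0 m.+1)) p_part -/(log2_fact _).
by rewrite -{1}(subnK le_m) expnD; ring.
Qed.

Lemma quotient_parity (X Y : nat) : 0 < Y ->
  X * m.+1`! = Y * (c * (2 ^ m * odd_prod a m)) ->
  [/\ Y %| X, odd (X %/ Y) <-> power_of_two m.+1
    & 2 ^ (m - log2_fact m.+1) * Y %| X].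
Proof.
move=> Y_gt0; have [u odd_u ->] := odd_quotientP.
rewrite mulnA => /eqP; rewrite eqn_pmul2r ?fact_gt0 // => /eqP ->.
split; first exact: dvdn_mulr.
  (* The quotient is odd exactly when the exponent of 2 vanishes. *)
  rewrite mulKn // oddM odd_u andbT oddX orbF subn_eq0 -log2_fact_maxP.
  by have := log2_fact_lt m.+1 isT; rewrite eqn_leq ltnS => ->.
by rewrite mulnA (mulnC Y) dvdn_mulr.
Qed.

End OddQuotient.

(** * Specialization to the Catalan quotients *)

Lemma central_bin_fact (n : nat) : 'C(2 * n, n) * (n`! * n`!) = (2 * n)`!.
Proof. by rewrite mul2n -addnn -(bin_fact (leq_addr n n)) addnK. Qed.

Lemma catalan_bin_quotient (k n : nat) : 0 < k ->
  catalan n * 'C(2 * k * n, 2 * n) * n.+1`! =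
  'C(k * n, n) * (2 ^ n * odd_prod ((k - 1) * n) n).
Proof.
case: k => // k _; rewrite subn1 /=.
have := fact_double_odd_prod (k * n) n; set P := 2 ^ n * _ => eq_P.
have eq_cat : catalan n * n.+1 = 'C(2 * n, n).
  by rewrite /catalan -[n.+1]addn1 divnK ?dvdn_catalan.
have eq_2n := central_bin_fact n.
have eq_2kn : 'C(2 * k.+1 * n, 2 * n) * ((2 * n)`! * (2 * (k * n))`!) =
    (2 * (k * n + n))`!.
  have le_n : 2 * n <= 2 * (k * n + n) by lia.
  by rewrite -(bin_fact le_n) -mulnBr addnK -(mulnA 2) (mulSnr k).
have eq_kn : 'C(k.+1 * n, n) * (n`! * (k * n)`!) = (k * n + n)`!.
  by rewrite -(bin_fact (leq_addl (k * n) n)) addnK mulSnr.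
apply/eqP; rewrite factS.
(* These factorials complete each binomial coefficient to a factorial identity. *)
have F_gt0 : 0 < n`! * ((2 * n)`! * (2 * (k * n))`!) * (k * n)`!.
  by rewrite !muln_gt0 !fact_gt0.
rewrite -(eqn_pmul2r F_gt0); apply/eqP.
transitivity ((catalan n * n.+1) * (n`! * n`!) *
  ('C(2 * k.+1 * n, 2 * n) * ((2 * n)`! * (2 * (k * n))`!)) * (k * n)`!).
  by ring.
rewrite eq_cat eq_2n eq_2kn -mulnA -eq_P -eq_kn.
by ring.
Qed.

Lemma gen_catalan_bin_quotient (k n : nat) : 0 < k ->
  gen_catalan (k - 1) n * 'C(2 * k * n, k * n) * ((k - 1) * n).+1`! =
  'C(2 * n, n) * (2 ^ ((k - 1) * n) * odd_prod n ((k - 1) * n)).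
Proof.
case: k => // k _; rewrite subn1 /=.
have := fact_double_odd_prod n (k * n); set P := 2 ^ (k * n) * _ => eq_P.
have eq_cat : gen_catalan k n * (k * n).+1 = 'C(k.+1 * n, n).
  by rewrite /gen_catalan -[k.+1]addn1 -[(k * n).+1]addn1 divnK ?dvdn_gen_catalan.
have eq_2n := central_bin_fact n.
have eq_2kn : 'C(2 * k.+1 * n, k.+1 * n) * ((n + k * n)`! * (n + k * n)`!) =
    (2 * (n + k * n))`!.
  by rewrite -central_bin_fact -(mulnA 2) (mulSn k).
have eq_kn : 'C(k.+1 * n, n) * (n`! * (k * n)`!) = (n + k * n)`!.
  by rewrite -(bin_fact (leq_addr (k * n) n)) addKn mulSn.
apply/eqP; rewrite factS.
have F_gt0 : 0 < n`! * n`! * ((n + k * n)`! * (n + k * n)`!).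
  by rewrite !muln_gt0 !fact_gt0.
rewrite -(eqn_pmul2r F_gt0); apply/eqP.
transitivity (((gen_catalan k n * (k * n).+1) * (n`! * (k * n)`!)) *
  ('C(2 * k.+1 * n, k.+1 * n) * ((n + k * n)`! * (n + k * n)`!)) * n`!).
  by ring.
rewrite eq_cat eq_kn eq_2kn -mulnA -eq_P -eq_2n.
by ring.
Qed.

(** Since [(2 k n + 1) + (2 k - 1) = 2 k (n + 1)], the two factors are opposite modulo any divisor
    of [n + 1]. *)
Lemma exchange_catalan (k n t : nat) : 0 < k ->
  (n.+1)`_2^' %| t * (2 * ((k - 1) * n + n) + 1) ->
  (n.+1)`_2^' %| t * (2 * k - 1).
Proof.
move=> k_gt0 dv_t; rewrite -(dvdn_addr _ dv_t) -mulnDr dvdn_mull //.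
rewrite (_ : _ + _ = 2 * k * n.+1); last by case: k k_gt0 {dv_t} => // k _; lia.
by rewrite dvdn_mull ?dvdn_part.
Qed.

Lemma exchange_gen_catalan (k n t : nat) : 0 < k ->
  (((k - 1) * n).+1)`_2^' %| t * (2 * (n + (k - 1) * n) + 1) ->
  (((k - 1) * n).+1)`_2^' %| t * odd_part (k + 1).
Proof.
case: k => // k _; rewrite subn1 /= (addn1 k.+1) => dv_t.
set o := _`_2^' in dv_t *.
have dv_o : o %| (k * n).+1 by exact: dvdn_part.
(* As [o] is odd, the power of 2 removed by [odd_part] can be put back. *)
have co_o : coprime o (2 ^ logn 2 k.+2).
  by rewrite coprimeXr // coprimen2 odd_partnC2.
rewrite -(Gauss_dvdl _ co_o) -mulnA /odd_part divnK ?pfactor_dvdnn //.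
(* [k (2 (n + k n) + 1) + (k + 2) = 2 (k + 1) (k n + 1)] *)
have dv_kt : o %| k * (t * (2 * (n + k * n) + 1)) by rewrite dvdn_mull.
rewrite -(dvdn_addr _ dv_kt) (_ : _ + _ = t * (2 * k.+1) * (k * n).+1).
  by rewrite dvdn_mull.
by rewrite -[k.+2]addn2 -[k.+1]addn1 -[(k * n).+1]addn1; ring.
Qed.

Lemma odd_odd_part (m : nat) : 0 < m -> odd (odd_part m).
Proof. by move=> m_gt0; rewrite odd_partE ?odd_partnC2. Qed.

Lemma gen_catalan_quotient_parity (k n : nat) : 0 < k ->
  let X := odd_part (k + 1) * gen_catalan (k - 1) n * 'C(2 * k * n, k * n) in
  let m := (k - 1) * n in
  [/\ 'C(2 * n, n) %| X,
      odd (X %/ 'C(2 * n, n)) <-> power_of_two m.+1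
    & 2 ^ (m - log2_fact m.+1) * 'C(2 * n, n) %| X].
Proof.
move=> k_gt0 X m; apply: (@quotient_parity n m (odd_part (k + 1))).
- by rewrite odd_odd_part ?addn1.
- by move=> t; exact: exchange_gen_catalan.
- by rewrite bin_gt0 mul2n -addnn leq_addr.
- by rewrite /X -!(mulnA (odd_part _)) gen_catalan_bin_quotient // mulnCA.
Qed.

Theorem theorem1p2 (k n : nat) (k_gt0 : 0 < k) (n_gt0 : 0 < n) :
  [/\ 'C(k * n, n) %| (2 * k - 1) * catalan n * 'C(2 * k * n, 2 * n)
        /\ (odd ((2 * k - 1) * catalan n * 'C(2 * k * n, 2 * n)
                   %/ 'C(k * n, n))
              <-> power_of_two (n + 1)),
      'C(2 * n, n) %|
          odd_part (k + 1) * gen_catalan (k - 1) n * 'C(2 * k * n, k * n)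
        /\ (odd (odd_part (k + 1) * gen_catalan (k - 1) n
                   * 'C(2 * k * n, k * n) %/ 'C(2 * n, n))
              <-> power_of_two ((k - 1) * n + 1))
    & 2 ^ (k - 1) * 'C(2 * n, n) %|
        'C(2 * (2 ^ k - 1) * n, (2 ^ k - 1) * n) * gen_catalan (2 ^ k - 2) n].
Proof.
split.
- rewrite addn1; set X := _ * 'C(2 * k * n, _).
  suff [] : [/\ 'C(k * n, n) %| X, odd (X %/ 'C(k * n, n)) <-> power_of_two n.+1
    & 2 ^ (n - log2_fact n.+1) * 'C(k * n, n) %| X] by [].
  apply: (@quotient_parity ((k - 1) * n) n (2 * k - 1)).
  + by lia.
  + by move=> t; exact: exchange_catalan.
  + by rewrite bin_gt0 leq_pmull.
  + by rewrite /X -!(mulnA (2 * k - 1)) catalan_bin_quotient // mulnCA.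
- by rewrite (addn1 (_ * n)); have [] := gen_catalan_quotient_parity k n k_gt0.
- have pow_gt1 : 1 < 2 ^ k by rewrite (ltn_exp2l 0).
  have [] := gen_catalan_quotient_parity (2 ^ k - 1) n; first by lia.
  move=> _ _; rewrite subnK ?(ltnW pow_gt1) // -subnDA.
  (* The odd part of [2 ^ k] is 1. *)
  rewrite /odd_part pfactorK // divnn expn_gt0 mul1n (mulnC (gen_catalan _ _)).
  apply: dvdn_trans; rewrite dvdn_pmul2r ?bin_gt0 ?mul2n -?addnn ?leq_addr //.
  rewrite dvdn_exp2l //.
  have Dk : 2 ^ k = 2 * 2 ^ (k - 1) by rewrite -expnS subn1 prednK.
  (* Dropping the last digit 1 of [(2 ^ k - 2) n + 1] and the 0 that doubling appends leaves a
     multiple of [2 ^ (k - 1) - 1]. *)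
  have -> : (2 ^ k - (1 + 1)) * n = 2 * ((2 ^ (k - 1)).-1 * n).
    by rewrite mulnA; congr (_ * _); lia.
  rewrite log2_fact_doubleS; set m := (_.-1 * n).
  (* [m = 0] forces [k = 1], where the required exponent is 0. *)
  have [m0|m_gt0] := posnP m.
    move/eqP: m0; rewrite muln_eq0 (gtn_eqF n_gt0) orbF.
    have [-> //|k1_gt0] := posnP (k - 1).
    by have : 1 < 2 ^ (k - 1) by [rewrite (ltn_exp2l 0)]; lia.
  by have := @log2_fact_mul_pred_pow2 (k - 1) m m_gt0 (dvdn_mulr _ (dvdnn _)); lia.
Qed.
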